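(* For any ribbon graph $G$, the partial-dual polynomial ${}^\partial\varepsilon_G(z)=\sum_{A\subseteq E(G)} z^{\varepsilon(G^A)}$ is either an even polynomial, an odd polynomial, or both even-interpolating and odd-interpolating.
   Context: A ribbon graph $G$ is a (possibly non-orientable) surface with boundary given as a union of a set $V(G)$ of vertex discs and a set $E(G)$ of edge discs such that vertices and edges meet in disjoint line segments, each such segment lies on the boundary of exactly one vertex and exactly one edge, and each edge contains exactly two such segments. With $v(G),e(G),f(G),c(G)$ the numbers of vertices, edges, boundary components and connected components, the Euler genus is $\varepsilon(G)=2c(G)-(v(G)-e(G)+f(G))$. For $A\subseteq E(G)$, the partial dual $G^A$ is obtained by gluing a disc along each boundary component of the spanning ribbon subgraph $(V(G),A)$ (these discs become the vertices of $G^A$), removing the interiors of all vertex discs of $G$, and keeping the edge discs unchanged. For a polynomial $p(z)=\sum_i c_iz^i$, $p$ has a gap of size $k$ at $c_i$ if $c_{i-1}c_{i+k}\neq0$ and $c_i=\dots=c_{i+k-1}=0$; $p$ is interpolating if it is nonzero and has no gaps. Writing $p(z)=p_e(z^2)+z\,p_o(z^2)$ with $p_e(z^2)$ the even-degree terms and $z\,p_o(z^2)$ the odd-degree terms, $p$ is even-interpolating (resp. odd-interpolating) if $p_e(z^2)$ (resp. $p_o(z^2)$) is interpolating. An even (resp. odd) polynomial is one whose only nonzero terms have even (resp. odd) degree. *)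

(* Defs.v *)
From HB Require Import structures.
From mathcomp Require Import all_boot all_order all_algebra.
Set Implicit Arguments. Unset Strict Implicit. Unset Printing Implicit Defensive.
Import Order.TTheory GRing.Theory Num.Theory.

(* Combinatorial encoding of a (possibly non-orientable) ribbon graph.
   Each edge disc is a rectangle whose four corners are the "flags"
   (e, s, t) : E * bool * bool.  The boolean s names the attaching segment
   (the end of the edge), t names the long side of the rectangle.
   - tA flips t : the two corners are the endpoints of the same
     edge/vertex attaching segment;
   - tE flips s : the two corners are the endpoints of the same long
     (free) side of the edge rectangle;
   - tV (data) : the two corners are joined by an arc of vertex-disc
     boundary between consecutive attaching segments.
   Vertex discs meeting no edge cannot be seen by flags; their number is
   recorded separately in [isol]. *)

Definition flag (E : finType) := (E * bool * bool)%type.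

Definition tA (E : finType) (x : flag E) : flag E :=
  let: (e, s, t) := x in (e, s, ~~ t).
Definition tE (E : finType) (x : flag E) : flag E :=
  let: (e, s, t) := x in (e, ~~ s, t).

Record ribbon_graph (E : finType) := RibbonGraph {
  tV : flag E -> flag E;
  tV_invol : involutive tV;
  tV_fpf : forall x, tV x != x;
  isol : nat
}.

Definition orbits2 (T : finType) (f g : T -> T) : nat :=
  n_comp [rel x y | (y == f x) || (y == g x)] predT.
Definition orbits3 (T : finType) (f g h : T -> T) : nat :=
  n_comp [rel x y | [|| y == f x, y == g x | y == h x]] predT.

Section Counts.
Variables (E : finType) (G : ribbon_graph E).
(* vertices = boundary circles of vertex discs *)
Definition nverts : nat := orbits2 (@tA E) (tV G) + isol G.
Definition nedges : nat := #|E|.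
(* boundary components of the surface *)
Definition nfaces : nat := orbits2 (@tE E) (tV G) + isol G.
Definition ncomps : nat := orbits3 (@tA E) (@tE E) (tV G) + isol G.
(* Euler genus 2c - (v - e + f); it is always >= 0, so the truncated
   natural-number subtraction below computes it exactly. *)
Definition euler_genus : nat := (2 * ncomps + nedges) - (nverts + nfaces).
End Counts.

(* Partial duality: for edges in A the roles of attaching segments and
   long sides are exchanged; relabel flags of A-edges by swapping (s,t). *)
Definition swapA (E : finType) (A : {set E}) (x : flag E) : flag E :=
  let: (e, s, t) := x in if e \in A then (e, t, s) else (e, s, t).

Lemma swapA_invol (E : finType) (A : {set E}) : involutive (swapA A).
Proof. by case=> [[e s] t] /=; case: ifP => He /=; rewrite ?He. Qed.

Definition pdual_tV (E : finType) (G : ribbon_graph E) (A : {set E}) :=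
  fun x => swapA A (tV G (swapA A x)).

Lemma pdual_tV_invol (E : finType) (G : ribbon_graph E) (A : {set E}) :
  involutive (pdual_tV G A).
Proof.
by move=> x; rewrite /pdual_tV swapA_invol tV_invol swapA_invol.
Qed.

Lemma pdual_tV_fpf (E : finType) (G : ribbon_graph E) (A : {set E}) x :
  pdual_tV G A x != x.
Proof.
rewrite /pdual_tV; apply/eqP => H.
have := tV_fpf G (swapA A x); rewrite -{2}H swapA_invol eqxx //.
Qed.

Definition partial_dual (E : finType) (G : ribbon_graph E) (A : {set E})
  : ribbon_graph E :=
  RibbonGraph (pdual_tV_invol G A) (@pdual_tV_fpf E G A) (isol G).

Local Open Scope ring_scope.

Definition pd_poly (E : finType) (G : ribbon_graph E) : {poly int} :=
  \sum_(A : {set E}) 'X^(euler_genus (partial_dual G A)).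

Definition has_gap_at (p : {poly int}) (i k : nat) : Prop :=
  (0 < i)%N /\ (0 < k)%N /\ p`_i.-1 * p`_(i + k) != 0 /\
  (forall j, (i <= j < i + k)%N -> p`_j = 0).

Definition interpolating (p : {poly int}) : Prop :=
  p != 0 /\ ~ (exists i k, has_gap_at p i k).

Definition even_interpolating (p : {poly int}) : Prop :=
  interpolating (even_poly p).
Definition odd_interpolating (p : {poly int}) : Prop :=
  interpolating (odd_poly p).

Definition even_polynomial (p : {poly int}) : Prop :=
  forall i, odd i -> p`_i = 0.
Definition odd_polynomial (p : {poly int}) : Prop :=
  forall i, ~~ odd i -> p`_i = 0.

(* Main.v *)
(* Let k(A) be the number of boundary circles of the spanning subgraph (V, A).
   The Euler genus of G^A is 2c + |E| - k(A) - k(E - A).  Toggling an edge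
   changes k by at most 1, hence the genus by at most 2.  If toggling any single
   edge of D splits a circle of (V, A), then one alternating 2-colouring of the
   flags is proper for A and for A toggled along any subset of D, so the circles
   are the cycles of a permutation of one colour class and each toggle multiplies
   it by a transposition; thus toggling D changes k by |D| mod 2.  Consequently a
   walk in the subset lattice cannot skip a genus having the parity of its end. *)
Require Import Defs.
From HB Require Import structures.
From mathcomp Require Import all_boot all_order all_algebra perm zify.
Set Implicit Arguments. Unset Strict Implicit. Unset Printing Implicit Defensive.

(** * Connected components as sets of classes *)

Section Classes.
Variables (T : finType) (e : rel T).
Hypothesis e_sym : connect_sym e.

Definition comp_of x : {set T} := [set y | connect e x y].

Lemma comp_of_eq x y : connect e x y -> comp_of x = comp_of y.
Proof. by move=> xy; apply/setP=> z; rewrite !inE (same_connect e_sym xy). Qed.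

(** Each class has a single root. Counting classes as sets lets components be compared with the
    cycles of a permutation. *)
Lemma n_comp_classes : n_comp e predT = #|[set comp_of x | x : T]|.
Proof.
rewrite /n_comp_mem.
have ->: [set comp_of x | x : T] = comp_of @: [set x | fingraph.roots e x].
  apply/setP=> X; apply/imsetP/imsetP=> -[x xP ->]; last by exists x.
  exists (fingraph.root e x); first by rewrite inE; exact: fingraph.roots_root.
  by apply/comp_of_eq/connect_root.
rewrite card_in_imset => [|x y]; first by apply: eq_card=> x; rewrite !inE andbT.
rewrite !inE => /eqP rx /eqP ry /setP/(_ y); rewrite !inE connect0.
by move=> /(fingraph.rootP e_sym); rewrite rx ry.
Qed.
End Classes.

Lemma n_comp_conj (T : finType) (e e' : rel T) (h : T -> T) :
  connect_sym e -> connect_sym e' -> involutive h ->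
  (forall x y, e x y = e' (h x) (h y)) -> n_comp e predT = n_comp e' predT.
Proof.
move=> es es' hK ee'.
have hom d d' : (forall x y, d x y = d' (h x) (h y)) ->
    forall x y, connect d x y -> connect d' (h x) (h y).
  move=> dd' x y /connectP[p dp ->]; elim: p x dp => [|z p IH] x //= /andP[xz zp].
  by rewrite dd' in xz; apply: connect_trans (connect1 xz) (IH _ zp).
have e'e x y : e' x y = e (h x) (h y) by rewrite ee' !hK.
rewrite (@adjunction_n_comp _ _ h e e' es es' predT) //; last split.
- by move=> x _; exists (h x); rewrite hK.
- move=> x y _; apply/idP/idP; first exact: hom.
  by move/(hom _ _ ee'); rewrite !hK.
Qed.

(** * Cycles of two involutions and their 2-colourings *)

(* A pair of fixed-point free involutions is a disjoint union of even cycles;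
   its alternating walks are the cycles of [s], two for every component. *)
Section AlternatingCycles.
Variables (T : finType) (f g : T -> T).
Hypotheses (fK : involutive f) (gK : involutive g).

Definition walk : {perm T} := perm (inj_comp (inv_inj gK) (inv_inj fK)).
Local Notation s := walk.

Lemma walkE x : s x = g (f x).
Proof. by rewrite permE. Qed.

Definition alternating (c : pred T) : Prop :=
  forall x, (c (f x) = ~~ c x) * (c (g x) = ~~ c x).

Lemma alternatingN c : alternating c -> alternating (predC c).
Proof. by move=> ca x; rewrite /= !ca. Qed.

Lemma alternating_porbit c x y : alternating c -> y \in porbit s x -> c y = c x.
Proof.
move=> ca /porbitP[i ->]; elim: i => [|i IH]; first by rewrite expg0 perm1.
by rewrite expgSr permM walkE !ca negbK.
Qed.

(** Conjugation by [f] turns [s] into its inverse, so [f] carries cycles to cycles. *)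
Lemma walk_mirror x y : y \in porbit s x -> f y \in porbit s (f x).
Proof.
case/porbitP=> i ->; rewrite porbit_sym; apply/porbitP; exists i.
elim: i x => [|i IH] x; first by rewrite !expg0 !perm1.
by rewrite [RHS](_ : _ = (s ^+ i)%g (f ((s ^+ i)%g x))) // {1}expgS expgSr !permM !walkE fK gK.
Qed.

Local Notation e := [rel x y | (y == f x) || (y == g x)].

Lemma orbits2_sym : connect_sym e.
Proof.
apply: sym_connect_sym => x y /=.
by rewrite [x == f y]eq_sym [x == g y]eq_sym (inv_eq fK) (inv_eq gK).
Qed.

Lemma connect_f x : connect e x (f x).
Proof. by apply: connect1; rewrite /= eqxx. Qed.

Lemma connect_g x : connect e x (g x).
Proof. by apply: connect1; rewrite /= eqxx orbT. Qed.

(** A component is a cycle of [s] together with its mirror image: an [f]-step passes to the mirror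
    cycle, and so does a [g]-step, as [g x] is [s (f x)]. *)
Lemma connect_porbit x y : connect e x y = (y \in porbit s x) || (f y \in porbit s x).
Proof.
have so z : s z \in porbit s z by rewrite -[s z]/((s ^+ 1)%g z) mem_porbit.
apply/idP/idP.
  case/connectP=> p ep ->; elim: p x ep => [|z p IH] x /=; first by rewrite porbit_id.
  case/andP=> xz zp; have {IH zp} := IH z zp; set y' := last z p.
  case/orP: xz => /eqP->.
    by case/orP=> /walk_mirror; rewrite !fK => ->; rewrite ?orbT.
  have gfx : g x \in porbit s (f x) by rewrite -{1}[x]fK -walkE.
  rewrite -eq_porbit_mem in gfx; rewrite (eqP gfx).
  by case/orP=> /walk_mirror; rewrite !fK => ->; rewrite ?orbT.
have con z : z \in porbit s x -> connect e x z.
  case/porbitP=> i ->; elim: i => [|i IH]; first by rewrite expg0 perm1.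
  rewrite expgSr permM walkE; apply: connect_trans IH _.
  exact: connect_trans (connect_f _) (connect_g _).
case/orP=> /con // xfy; apply: connect_trans xfy _; rewrite -{2}[y]fK; exact: connect_f.
Qed.

Hypotheses (f0 : forall x, f x != x) (g0 : forall x, g x != x).

(** If [f x] were [s ^+ i] of [x], cutting one step off both ends would give the same for [s x] with
    [i - 2]. The descent ends at a fixed point of [f] (i = 0) or of [g] (i = 1). *)
Lemma mirror_notin_porbit x : f x \notin porbit s x.
Proof.
apply/porbitP=> -[i]; move: i {2}i.+1 (ltnSn i) x => i n.
elim: n i => // n IH [|[|i]] lt_in x.
- by rewrite expg0 perm1 => /eqP; rewrite (negPf (f0 x)).
- by rewrite expg1 walkE => /esym/eqP; rewrite (negPf (g0 _)).
- rewrite expgS permM expgSr permM [RHS]walkE => /(congr1 g); rewrite gK => /(congr1 f).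
  rewrite fK => sfx; apply: (IH i _ (s x)); first by rewrite -ltnS ltnW.
  by rewrite -sfx walkE.
Qed.

Lemma alternating_exists : exists c, alternating c.
Proof.
(* Mirror cycles are distinct, so comparing their ranks colours exactly one of the two. *)
pose r x := enum_rank (porbit s x); exists (fun x => r x < r (f x)).
have rN x : (r (f x) < r (f (f x))) = ~~ (r x < r (f x)).
  rewrite fK -leqNgt ltn_neqAle; case: eqP => //= /val_inj/enum_rank_inj E.
  by have:= mirror_notin_porbit x; rewrite -eq_porbit_mem E eqxx.
have rs x : r (s x) = r x by rewrite /r -[s x]/((s ^+ 1)%g x) porbit_perm.
have rfs x : r (f (s x)) = r (f x).
  rewrite /r; congr enum_rank; apply/eqP; rewrite eq_porbit_mem walk_mirror //.
  by rewrite -[s x]/((s ^+ 1)%g x) mem_porbit.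
move=> x; split; first exact: rN.
by rewrite -[x in g x]fK -walkE rs rfs rN.
Qed.

(** A colouring is constant on each cycle and opposite on its mirror image, so exactly one of the
    two cycles of a component is coloured. *)
Lemma n_comp_alternating c : alternating c ->
  n_comp e predT = #|[set porbit s x | x in c]|.
Proof.
move=> ca; rewrite (n_comp_classes orbits2_sym).
pose F (X : {set T}) := X :|: f @: X.
have FE x : F (porbit s x) = comp_of e x.
  apply/setP=> y; rewrite !inE connect_porbit; congr (_ || _).
  by rewrite -{1}[y]fK (mem_imset _ _ (inv_inj fK)).
have -> : [set comp_of e x | x : T] = F @: [set porbit s x | x in c].
  rewrite -imset_comp; apply/setP=> X; apply/imsetP/imsetP=> -[x xc ->]; last by exists x; rewrite /= ?FE.
  case cx: (c x); first by exists x; rewrite /= ?FE.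
  exists (f x); first by rewrite unfold_in ca cx.
  by rewrite /= FE; apply: comp_of_eq; [exact: orbits2_sym | exact: connect_f].
rewrite card_in_imset // => _ _ /imsetP[x xc ->] /imsetP[y yc ->].
rewrite !FE => /setP/(_ y); rewrite !inE connect0 connect_porbit.
case/orP=> [yx|/(alternating_porbit ca)].
  by apply/eqP; rewrite eq_porbit_mem porbit_sym.
by rewrite ca; move: xc yc; rewrite !unfold_in => -> ->.
Qed.

Lemma card_porbits_walk : #|porbits s| = (n_comp e predT).*2.
Proof.
have [c ca] := alternating_exists.
have -> : porbits s = [set porbit s x | x in c] :|: [set porbit s x | x in predC c].
  apply/setP=> X; rewrite inE; apply/imsetP/orP=> [[x _ ->]|[]/imsetP[x _ ->]]; try by exists x.
  by case cx: (c x); [left | right]; apply: imset_f; rewrite unfold_in /= cx.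
rewrite cardsU disjoint_setI0 ?cards0 ?subn0.
  by rewrite -(n_comp_alternating ca) -(n_comp_alternating (alternatingN ca)) addnn.
apply/pred0P=> X /=; apply/negP=> /andP[/imsetP[x xc ->] /imsetP[y yc]] /eqP.
rewrite eq_porbit_mem => /(alternating_porbit ca).
by move: xc yc; rewrite !unfold_in /= => -> /negPf->.
Qed.

Section HalfWalk.
Variables (c : pred T) (ca : alternating c).

Lemma half_walk_inj : injective (fun x => if c x then g (f x) else x).
Proof.
move=> x y; case cx: (c x); case cy: (c y) => //; first by move/(inv_inj gK)/(inv_inj fK).
  by move=> E; move: cy; rewrite -E !ca cx.
by move=> E; move: cx; rewrite E !ca cy.
Qed.

(** The full walk has two cycles per component, so its sign forgets the parity of their number.
    Restricted to one colour it has one cycle per component, besides fixed points. *)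
Definition half_walk : {perm T} := perm half_walk_inj.

Lemma porbit_half_walk x : porbit half_walk x = if c x then porbit s x else [set x].
Proof.
have iter_half y i : c y -> (half_walk ^+ i)%g y = (s ^+ i)%g y.
  move=> cy; elim: i => [|i IH]; first by rewrite !expg0.
  rewrite !expgSr !permM IH walkE permE.
  by rewrite (alternating_porbit ca (mem_porbit s i y)) cy.
apply/setP=> y; case cx: (c x).
  by apply/porbitP/porbitP=> -[i ->]; exists i; rewrite iter_half.
rewrite inE; apply/porbitP/eqP=> [[i ->]|->]; last by exists 0; rewrite expg0 perm1.
by elim: i => [|i IH]; [rewrite expg0 perm1 | rewrite expgSr permM IH permE cx].
Qed.

Lemma odd_half_walk : odd_perm half_walk = odd #|c| (+) odd (n_comp e predT).
Proof.
rewrite /odd_perm (n_comp_alternating ca).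
have -> : porbits half_walk = [set porbit s x | x in c] :|: [set [set x] | x in predC c].
  apply/setP=> X; rewrite inE; apply/imsetP/orP=> [[x _ ->]|].
    rewrite porbit_half_walk; case cx: (c x); [left | right];
    by apply: imset_f; rewrite unfold_in /= cx.
  case=> /imsetP[x xc ->]; exists x => //; rewrite porbit_half_walk; move: xc.
    by rewrite unfold_in => ->.
  by rewrite unfold_in /= => /negPf->.
rewrite cardsU disjoint_setI0 ?cards0 ?subn0.
  (* The fixed points outside [c] cancel against their share of the cardinal of [T]. *)
  rewrite (card_imset _ (@set1_inj _)) oddD -(cardC c) oddD.
  by do 3!case: (odd _).
apply/pred0P=> X /=; apply/negP=> /andP[/imsetP[x xc ->] /imsetP[y yc]] E.
have /(alternating_porbit ca) : y \in porbit s x by rewrite E inE.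
by move: xc yc; rewrite !unfold_in /= => -> /negPf->.
Qed.
End HalfWalk.

End AlternatingCycles.

(** * Effect of one resmoothing on the number of cycles *)

(* [f'] re-pairs the two [f]-pairs {x, f x} and {f' x, f (f' x)}. *)
Definition resmoothing (T : finType) (f f' : T -> T) (x : T) : Prop :=
  f' (f x) = f (f' x) /\
  forall y, y \notin [:: x; f x; f' x; f (f' x)] -> f' y = f y.

Section Resmoothing.
Variables (T : finType) (f f' g : T -> T) (x : T).
Hypotheses (fK : involutive f) (f'K : involutive f') (gK : involutive g).
Hypotheses (f0 : forall x, f x != x) (f'0 : forall x, f' x != x).
Hypotheses (g0 : forall x, g x != x).
Hypotheses (ff'x : f x != f' x) (rx : resmoothing f f' x).

Local Notation k := (orbits2 f g).
Local Notation k' := (orbits2 f' g).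
Local Notation s := (walk fK gK).
Local Notation s' := (walk f'K gK).

(** Exchanging [x] with [f (f' x)] before [f] gives them the partners they have under [f']; the
    second transposition does the same for their mirror images. *)
Lemma walk_resmoothing :
  s' = (tperm x (f (f' x)) * (tperm (f x) (f' x) * s))%g.
Proof.
case: rx => f'f f'y; apply/permP=> y; rewrite !permM !walkE; congr g.
have d1 : x != f (f' x) by apply: contraNneq ff'x => {1}->; rewrite fK.
have d2 := f0 x; have d3 := f'0 x; have d4 : f' x != f (f' x) by rewrite eq_sym.
have d5 : f x != f (f' x) by rewrite (inj_eq (inv_inj fK)) eq_sym.
have [->|nx] := eqVneq y x.
  by rewrite tpermL tpermD ?fK.
have [->|nffx] := eqVneq y (f (f' x)).
  by rewrite tpermR tpermD // -f'f f'K.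
rewrite [X in tperm _ _ X]tpermD 1?eq_sym //.
have [->|nfx] := eqVneq y (f x); first by rewrite tpermL.
have [->|nf'x] := eqVneq y (f' x); first by rewrite tpermR fK f'K.
by rewrite tpermD 1?eq_sym // f'y // !inE !negb_or nx nfx nf'x.
Qed.

Lemma leq_orbits2_resmoothing : k' <= k.+1.
Proof.
have := card_porbits_walk f'K gK f'0 g0; have := card_porbits_walk fK gK f0 g0.
rewrite walk_resmoothing => E E'.
have := porbits_mul_tperm (tperm (f x) (f' x) * s) x (f (f' x)).
have /= := porbits_mul_tperm s (f x) (f' x).
rewrite /= E E' -/(orbits2 f g) -/(orbits2 f' g) => H1 H2.
(* Two transpositions add at most two cycles, that is, one component. *)
rewrite -leq_double doubleS; apply: leq_trans (leq_trans (leq_addr _ _) (eq_leq H2)) _.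
rewrite -addn2 -[2]/(1 + 1) addnA; apply: leq_add (leq_b1 _).
by apply: leq_trans (leq_trans (leq_addr _ _) (eq_leq H1)) _; rewrite leq_add2l leq_b1.
Qed.

(** A new component requires both transpositions to add a cycle, and the one applied to [s] does so
    only if it exchanges two points of one cycle. *)
Lemma split_resmoothing : k' = k.+1 -> f x \in porbit s (f' x).
Proof.
move=> kk'.
have := card_porbits_walk f'K gK f'0 g0; have := card_porbits_walk fK gK f0 g0.
rewrite walk_resmoothing => E E'.
have := porbits_mul_tperm (tperm (f x) (f' x) * s) x (f (f' x)).
have /= := porbits_mul_tperm s (f x) (f' x).
rewrite /= E E' -/(orbits2 f g) -/(orbits2 f' g) kk'.
case: (f x \in _) => //=; rewrite ff'x addn1 addn2 => -[H1] H2.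
have: (k.+1).*2 <= #|porbits (tperm (f x) (f' x) * s)| + 1.
  by apply: leq_trans (leq_trans (leq_addr _ _) (eq_leq H2)) _; rewrite leq_add2l leq_b1.
by rewrite addn1 H1 doubleS ltnNge leqnSn.
Qed.

Lemma split_alternating c : k' = k.+1 -> alternating f g c -> c (f' x) = ~~ c x.
Proof.
move=> /split_resmoothing /[swap] ca /(alternating_porbit ca) <-.
by rewrite ca.
Qed.
End Resmoothing.

Lemma resmoothing_mate (T : finType) (f f' : T -> T) (x : T) :
  involutive f -> resmoothing f f' x -> resmoothing f f' (f x).
Proof.
move=> fK [f'f f'y]; split; first by rewrite fK f'f fK.
by move=> y; rewrite f'f !fK => yn; apply: f'y; apply: contraNN yn; rewrite !inE; do 4!case: eqP.
Qed.

Section ResmoothingParity.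
Variables (T : finType) (f f' g : T -> T) (c : pred T).
Hypotheses (fK : involutive f) (f'K : involutive f') (gK : involutive g).
Hypotheses (f0 : forall x, f x != x) (f'0 : forall x, f' x != x).
Hypotheses (g0 : forall x, g x != x).
Hypotheses (ca : alternating f g c) (ca' : alternating f' g c).

Lemma odd_orbits2_alternating x : f x != f' x -> resmoothing f f' x ->
  odd (orbits2 f' g) = ~~ odd (orbits2 f g).
Proof.
wlog cx : x / c x.
  move=> IH ff'x rx; case cx: (c x); first exact: (IH x).
  apply: (IH (f x)); [by rewrite ca cx | | exact: resmoothing_mate].
  by case: rx => -> _; rewrite (inj_eq (inv_inj fK)).
move=> ff'x rx.
have -> : odd (orbits2 f' g) = odd #|c| (+) half_walk f'K gK ca'.
  by rewrite odd_half_walk // addbA addbb.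
have -> : odd (orbits2 f g) = odd #|c| (+) half_walk fK gK ca.
  by rewrite odd_half_walk // addbA addbb.
(* Of the two transpositions only the one inside the colour class survives, so the sign flips. *)
have -> : half_walk f'K gK ca' = (tperm x (f (f' x)) * half_walk fK gK ca)%g.
  have cy : c (f (f' x)) by rewrite ca ca' negbK.
  case: rx => f'f f'y; apply/permP=> y; rewrite permM !permE /=.
  have [->|nx] := eqVneq y x; first by rewrite cx cy fK.
  have [->|nffx] := eqVneq y (f (f' x)); first by rewrite cx cy -f'f f'K.
  case: ifP => // cyy; congr g; apply: f'y; rewrite !inE !negb_or nx nffx /= andbT.
  by apply/andP; split; apply: contraTneq cyy => ->; rewrite ?ca ?ca' cx.
rewrite odd_mul_tperm addbCA.
have -> : x != f (f' x) by apply: contraNneq ff'x => {1}->; rewrite fK.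
by [].
Qed.
End ResmoothingParity.

(** Only four flags are re-paired, and properness at [x] forces it at the other three. *)
Lemma alternating_resmoothing (T : finType) (f f' g : T -> T) (x : T) (c : pred T) :
  involutive f' -> resmoothing f f' x -> alternating f g c ->
  c (f' x) = ~~ c x -> alternating f' g c.
Proof.
move=> f'K [f'f f'y] ca cx y; split; last exact: (ca y).2.
have [|/f'y->] := boolP (y \in [:: x; f x; f' x; f (f' x)]); last exact: (ca y).1.
rewrite !inE => /or4P[]/eqP->; first exact: cx.
- by rewrite f'f !ca cx.
- by rewrite f'K cx negbK.
- by rewrite -f'f f'K f'f !ca cx negbK.
Qed.

(** * Symmetric differences and toggling of edges *)

Section SymmetricDifference.
Variable E : finType.
Implicit Types (A B : {set E}) (e : E).

Definition symd A B : {set E} := [set i | (i \in A) (+) (i \in B)].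
Definition toggle A e : {set E} := symd A [set e].

Lemma in_toggle A e i : (i \in toggle A e) = (i \in A) (+) (i == e).
Proof. by rewrite !inE. Qed.

Lemma symd_eq0 A B : #|symd A B| = 0 -> A = B.
Proof.
move/eqP; rewrite cards_eq0 => /eqP/setP AB; apply/setP=> i.
by have:= AB i; rewrite !inE; do 2!case: (_ \in _).
Qed.

Lemma card_symd_toggle A B e : e \in symd A B -> #|symd A B| = #|symd (toggle A e) B|.+1.
Proof.
move=> eAB; rewrite (cardsD1 e) eAB; congr _.+1; apply: eq_card => i.
move: eAB; rewrite !inE; case: eqP => [->|_]; last by rewrite addbF.
by do 2!case: (_ \in _).
Qed.

Lemma symd_setC A B : symd (~: A) (~: B) = symd A B.
Proof. by apply/setP=> i; rewrite !inE addbN addNb negbK. Qed.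

Lemma setC_toggle A e : ~: toggle A e = toggle (~: A) e.
Proof. by apply/setP=> i; rewrite !inE addNb. Qed.

Lemma card_symd_setC A B : #|symd A B| + #|symd (~: A) B| = #|E|.
Proof.
rewrite -(cardsC (symd A B)); congr (_ + _); apply: eq_card => i.
by rewrite !inE addNb.
Qed.
End SymmetricDifference.

(** * Orbit counts under conjugation *)

Lemma orbits3_sym (T : finType) (f1 f2 f3 : T -> T) :
  involutive f1 -> involutive f2 -> involutive f3 ->
  connect_sym [rel x y | [|| y == f1 x, y == f2 x | y == f3 x]].
Proof.
move=> K1 K2 K3; apply: sym_connect_sym => x y /=.
by rewrite [x == f1 y]eq_sym [x == f2 y]eq_sym [x == f3 y]eq_sym !inv_eq.
Qed.

Lemma orbits2_conj (T : finType) (f1 f2 f1' f2' h : T -> T) :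
  involutive f1 -> involutive f2 -> involutive f1' -> involutive f2' ->
  involutive h -> (forall x, h (f1 x) = f1' (h x)) ->
  (forall x, h (f2 x) = f2' (h x)) -> orbits2 f1 f2 = orbits2 f1' f2'.
Proof.
move=> K1 K2 K1' K2' hK h1 h2.
apply: (n_comp_conj (orbits2_sym K1 K2) (orbits2_sym K1' K2') hK) => x y /=.
by rewrite -h1 -h2 !(inj_eq (inv_inj hK)).
Qed.

Lemma orbits3_conj (T : finType) (f1 f2 f3 f3' h : T -> T) :
  involutive f1 -> involutive f2 -> involutive f3 -> involutive f3' ->
  involutive h ->
  (forall x, h (f1 x) = f1 (h x) /\ h (f2 x) = f2 (h x) \/
             h (f1 x) = f2 (h x) /\ h (f2 x) = f1 (h x)) ->
  (forall x, h (f3 x) = f3' (h x)) -> orbits3 f1 f2 f3 = orbits3 f1 f2 f3'.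
Proof.
move=> K1 K2 K3 K3' hK h12 h3.
apply: (n_comp_conj (orbits3_sym K1 K2 K3) (orbits3_sym K1 K2 K3') hK) => x y /=.
by case: (h12 x) => -[<- <-]; rewrite -h3 !(inj_eq (inv_inj hK)) // orbCA.
Qed.

(** * Flag pairings along the boundary of a spanning subgraph *)

Section EdgePairings.
Variable E : finType.
Implicit Types (A B : {set E}) (e : E) (x : flag E).

Lemma tAK : involutive (@tA E).
Proof. by case=> [[e s] t] /=; rewrite negbK. Qed.

Lemma tEK : involutive (@tE E).
Proof. by case=> [[e s] t] /=; rewrite negbK. Qed.

(** The boundary of (V, A) follows the long sides of an edge in A and the attaching segments of an
    edge outside A. *)
Definition smooth A x : flag E := if x.1.1 \in A then tE x else tA x.

Lemma smoothK A : involutive (smooth A).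
Proof. by case=> [[e s] t]; rewrite /smooth /=; case eA: (e \in A); rewrite /= eA /= negbK. Qed.

Lemma smooth_neq A x : smooth A x != x.
Proof.
by case: x => [[e s] t]; rewrite /smooth; case: ifP => _ /=; rewrite !xpair_eqE eqxx;
  case: s t => [] [].
Qed.

Lemma smooth_toggle_neq A x : smooth A x != smooth (toggle A x.1.1) x.
Proof.
case: x => [[e s] t]; rewrite /smooth in_toggle eqxx addbT.
by case: (e \in A) => /=; rewrite !xpair_eqE eqxx; case: s t => [] [].
Qed.

Lemma smooth_resmoothing A x : resmoothing (smooth A) (smooth (toggle A x.1.1)) x.
Proof.
case: x => [[e s] t]; split=> [|[[e' s'] t']].
  by rewrite /smooth !in_toggle /=; case eA: (e \in A); rewrite /= !(eqxx, eA).
rewrite /smooth !in_toggle /= eqxx addbT; have [->|_ _] := eqVneq e' e; last by rewrite addbF.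
rewrite !inE /= !negb_or.
by case eA: (e \in A); rewrite /= !(eqxx, eA) /= !xpair_eqE !eqxx; case: s t s' t' => [] [] [] [].
Qed.
End EdgePairings.

(** * Boundary circles and the Euler genus of partial duals *)

(* Boundary circles of the spanning ribbon subgraph (V, A), isolated vertices
   excepted.  Locked, lest conversion try to evaluate [n_comp]. *)
HB.lock Definition ncirc (E : finType) (G : ribbon_graph E) (A : {set E}) : nat :=
  orbits2 (smooth A) (tV G).

Section Ribbon.
Variables (E : finType) (G : ribbon_graph E).
Implicit Types (A B : {set E}) (e : E) (x : flag E) (c : pred (flag E)).
Local Notation g := (tV G).
Local Notation gK := (tV_invol G).
Local Notation g0 := (tV_fpf G).
Local Notation sK := (@smoothK E).
Local Notation s0 := (@smooth_neq E _).

Local Notation k := (ncirc G).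
Local Notation c3 := (orbits3 (@tA E) (@tE E) g).

Lemma ncircE A : k A = orbits2 (smooth A) g.
Proof. by rewrite ncirc.unlock. Qed.

Lemma nverts_partial_dual A : nverts (partial_dual G A) = k A + isol G.
Proof.
suff E' : orbits2 (@tA E) (tV (partial_dual G A)) = k A.
  by rewrite /nverts E'.
rewrite ncircE.
apply: (orbits2_conj (@tAK E) (pdual_tV_invol G A) (sK A) gK (swapA_invol A)) => x.
  by case: x => [[e s] t]; rewrite /smooth /=; case: ifP => eA /=; rewrite eA.
by rewrite /= /pdual_tV swapA_invol.
Qed.

(** Under [swapA A] the long sides of the dual become attaching segments on A and stay long sides
    elsewhere: the pairing of the complement. *)
Lemma nfaces_partial_dual A : nfaces (partial_dual G A) = k (~: A) + isol G.
Proof.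
suff E' : orbits2 (@tE E) (tV (partial_dual G A)) = k (~: A).
  by rewrite /nfaces E'.
rewrite ncircE.
apply: (orbits2_conj (@tEK E) (pdual_tV_invol G A) (sK _) gK (swapA_invol A)) => x.
  by case: x => [[e s] t]; rewrite /smooth /= ?inE; case: ifP => eA /=; rewrite eA.
by rewrite /= /pdual_tV swapA_invol.
Qed.

Lemma ncomps_partial_dual A : ncomps (partial_dual G A) = c3 + isol G.
Proof.
suff E' : orbits3 (@tA E) (@tE E) (tV (partial_dual G A)) = c3.
  by rewrite /ncomps E'.
apply: (orbits3_conj (@tAK E) (@tEK E) (pdual_tV_invol G A) gK (swapA_invol A)) => x.
  by case: x => [[e s] t] /=; case: ifP => _; [right | left].
by rewrite /= /pdual_tV swapA_invol.
Qed.

Lemma leq_ncirc_toggle A e : k (toggle A e) <= (k A).+1.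
Proof.
rewrite !ncircE; apply: (@leq_orbits2_resmoothing _ _ _ _ (e, false, false) (sK _) (sK _) gK s0 s0 g0).
- exact: (smooth_toggle_neq A (e, false, false)).
- exact: (smooth_resmoothing A (e, false, false)).
Qed.

Lemma toggleK A e : toggle (toggle A e) e = A.
Proof. by apply/setP=> i; rewrite !in_toggle -addbA addbb addbF. Qed.

Lemma leq_ncirc_toggleV A e : k A <= (k (toggle A e)).+1.
Proof. by rewrite -{1}[A](toggleK A e) leq_ncirc_toggle. Qed.

Lemma leq_ncirc_symd A B : k A <= k B + #|symd A B|.
Proof.
move: {2}#|_| (erefl #|symd A B|) => n; elim: n A => [|n IH] A dAB.
  by rewrite (symd_eq0 dAB) leq_addr.
have /card_gt0P[e eAB]: 0 < #|symd A B| by rewrite dAB.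
rewrite (card_symd_toggle eAB) addnS; apply: leq_trans (leq_ncirc_toggleV A e) _.
by rewrite ltnS IH //; move: dAB; rewrite (card_symd_toggle eAB) => -[].
Qed.

Lemma odd_ncirc_toggle A e c : alternating (smooth A) g c ->
  alternating (smooth (toggle A e)) g c -> odd (k (toggle A e)) = ~~ odd (k A).
Proof.
move=> ca ca'; rewrite !ncircE.
apply: (odd_orbits2_alternating (sK _) (sK _) gK ca ca').
- exact: (smooth_toggle_neq A (e, false, false)).
- exact: (smooth_resmoothing A (e, false, false)).
Qed.

Lemma odd_ncirc_symd A B c : alternating (smooth A) g c ->
  alternating (smooth B) g c -> odd (k B) = odd (k A) (+) odd #|symd A B|.
Proof.
move: {2}#|_| (erefl #|symd A B|) => n; elim: n A => [|n IH] A dAB ca cb.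
  by rewrite dAB (symd_eq0 dAB) addbF.
have /card_gt0P[e eAB]: 0 < #|symd A B| by rewrite dAB.
(* At each edge the intermediate set pairs flags as A or as B does, so [c] stays proper. *)
have ca' : alternating (smooth (toggle A e)) g c.
  move=> x; split; last exact: (ca x).2.
  rewrite /smooth in_toggle; have [xe|_] := eqVneq x.1.1 e; last by rewrite addbF; exact: (ca x).1.
  have := (cb x).1; rewrite /smooth xe; move: eAB; rewrite inE addbT.
  by do 2!case: (e \in _).
rewrite (card_symd_toggle eAB) /= (IH _ _ ca' cb); last first.
  by move: dAB; rewrite (card_symd_toggle eAB) => -[].
by rewrite (odd_ncirc_toggle ca ca') addNb addbN.
Qed.

(** Properness is checked edge by edge, so splits by single toggles of A suffice to toggle any of
    these edges together. *)
Lemma alternating_of_splits A B c : alternating (smooth A) g c ->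
  (forall e, e \in symd A B -> k (toggle A e) = (k A).+1) ->
  alternating (smooth B) g c.
Proof.
move=> ca kS x; split; last exact: (ca x).2.
have [xAB|xAB] := boolP (x.1.1 \in symd A B); last first.
  have := (ca x).1; rewrite /smooth; move: xAB; rewrite inE.
  by do 2!case: (x.1.1 \in _).
have := kS _ xAB; rewrite !ncircE => kS'.
have := split_alternating (sK _) (sK _) gK s0 s0 g0
  (smooth_toggle_neq A x) (smooth_resmoothing A x) kS' ca.
rewrite /smooth in_toggle eqxx addbT; move: xAB; rewrite inE.
by do 2!case: (x.1.1 \in _).
Qed.

(* At a minimiser of [ncirc] no toggle merges two circles, so each circle is
   already a whole connected component. *)
Lemma ncirc_min : exists A, k A = c3.
Proof.
pose A := [arg min_(B < set0) k B]; exists A.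
have Amin B : k A <= k B by rewrite /A; case: arg_minnP => // i _; apply.
rewrite ncircE; apply: eq_n_comp => x y.
set r2 := (X in connect X x y); set r3 := (X in _ = connect X x y).
(* Both partners of [z] lie on its circle: otherwise some colouring is proper before and after the
   toggle, so parity and minimality force a split, which puts them on one circle. *)
have con z : connect r2 z (smooth (toggle A z.1.1) z).
  apply/idPn=> ncon; set f' := smooth _ in ncon.
  have [c ca cz] : exists2 c, alternating (smooth A) g c & c (f' z) = ~~ c z.
    have [c ca] := alternating_exists (sK A) gK s0 g0.
    have [cz|/eqP] := eqVneq (c (f' z)) (~~ c z); first by exists c.
    (* Flipping the colours on the circle of [z] alone keeps [c] proper and separates [z] from
       [f' z]. *)
    rewrite -addbT => cz; exists (fun w => c w (+) connect r2 z w); last first.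
      rewrite connect0 (negPf ncon) addbF; move: cz.
      by case: (c _) (c z) => [] [].
    have sym := orbits2_sym (sK A) gK.
    move=> w; split; rewrite !ca addNb; congr (~~ (_ (+) _)); rewrite !(sym z).
      exact/esym/(same_connect sym (connect_f _ _ w)).
    exact/esym/(same_connect sym (connect_g _ _ w)).
  have ca' := alternating_resmoothing (sK _) (smooth_resmoothing A z) ca cz.
  have kS : k (toggle A z.1.1) = (k A).+1.
    apply/eqP; rewrite eqn_leq leq_ncirc_toggle ltn_neqAle Amin andbT.
    by apply/negP=> /eqP kE; have := odd_ncirc_toggle ca ca'; rewrite -kE; case: odd.
  rewrite !ncircE in kS.
  have := split_resmoothing (sK _) (sK _) gK s0 s0 g0
    (smooth_toggle_neq A z) (smooth_resmoothing A z) kS.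
  rewrite -eq_porbit_mem eq_sym eq_porbit_mem => fp.
  case/negP: ncon; apply: connect_trans (connect_f _ _ z) _.
  by rewrite (connect_porbit (sK A) gK) fp.
have r23 z w : r2 z w -> connect r3 z w.
  case/orP=> /eqP->; apply: connect1; rewrite /r3 /=; last by rewrite eqxx !orbT.
  by rewrite /smooth; case: ifP => _; rewrite eqxx ?orbT.
have r32 z w : r3 z w -> connect r2 z w.
  have cs : connect r2 z (smooth A z) by exact: connect_f.
  have := con z; move: cs; rewrite /smooth in_toggle eqxx addbT.
  case: (z.1.1 \in A) => /= c1 c2 /or3P[]/eqP-> //; exact: connect_g.
by apply/idP/idP; [apply: (connect_sub r23) | apply: (connect_sub r32)].
Qed.

(** The distances of A and its complement from a minimiser add up to the number of edges. This makes
    the truncated subtraction in [euler_genus] exact. *)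
Lemma leq_ncirc_setC A : k A + k (~: A) <= 2 * c3 + #|E|.
Proof.
have [B <-] := ncirc_min.
rewrite mul2n -addnn -(card_symd_setC A B) addnACA.
by apply: leq_add; exact: leq_ncirc_symd.
Qed.

Lemma euler_genus_partial_dual A :
  euler_genus (partial_dual G A) + (k A + k (~: A)) = 2 * c3 + #|E|.
Proof.
rewrite /euler_genus nverts_partial_dual nfaces_partial_dual ncomps_partial_dual.
have := leq_ncirc_setC A; rewrite /nedges; lia.
Qed.
End Ribbon.

(** * Intermediate values of the genus *)

Section GenusSpectrum.
Variables (E : finType) (G : ribbon_graph E).
Implicit Types (A B : {set E}) (e : E).
Local Notation k := (ncirc G).
Local Notation genus A := (euler_genus (partial_dual G A)).

(* Along a walk from B2 to B1 the genus changes by at most 2, so it can only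
   jump over m by a drop from m + 1 to m - 1 that splits a circle of both
   (V, A) and (V, E - A); when all toggles towards B1 do this, one alternating
   colouring serves B2 and B1 and forces genus B1 = m + 1 mod 2. *)
Lemma genus_intermediate m B1 B2 : genus B1 < m -> m <= genus B2 ->
  odd (genus B1) = odd m -> exists A, genus A = m.
Proof.
move=> lt1 le2 odd1.
move: {2}#|_| (erefl #|symd B2 B1|) => n; elim: n B2 le2 => [|n IH] B2 le2 d.
  by move: lt1; rewrite -(symd_eq0 d) ltnNge le2.
have [->|ne2] := eqVneq m (genus B2); first by exists B2.
have [/existsP[e /andP[eB le_e]]|] :=
  boolP [exists e, (e \in symd B2 B1) && (m <= genus (toggle B2 e))].
  by apply: IH le_e _; move: d; rewrite (card_symd_toggle eB) => -[].
rewrite negb_exists => /forallP none.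
(* Now every toggle towards B1 falls from above m to below m. Since each circle count grows by at
   most one, both must grow. *)
have split2 e : e \in symd B2 B1 -> [/\ k (toggle B2 e) = (k B2).+1,
    k (toggle (~: B2) e) = (k (~: B2)).+1 & genus B2 = m.+1].
  move=> eB; have := none e; rewrite eB -ltnNge => lt_e.
  have := euler_genus_partial_dual G B2.
  have := euler_genus_partial_dual G (toggle B2 e); rewrite setC_toggle.
  have := leq_ncirc_toggle G B2 e; have := leq_ncirc_toggle G (~: B2) e.
  by move=> *; split; lia.
have /card_gt0P[e0 e0B] : 0 < #|symd B2 B1| by rewrite d.
have [_ _ g2] := split2 _ e0B.
have oddS A B : (forall e, e \in symd A B -> k (toggle A e) = (k A).+1) ->
    odd (k B) = odd (k A) (+) odd #|symd A B|.
  move=> kS; have [c ca] := alternating_exists (@smoothK E A) (tV_invol G)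
    (@smooth_neq E A) (tV_fpf G).
  exact: odd_ncirc_symd ca (alternating_of_splits ca kS).
have oddB := oddS _ _ (fun e eB => let: And3 kS _ _ := split2 e eB in kS).
have oddC : odd (k (~: B1)) = odd (k (~: B2)) (+) odd #|symd B2 B1|.
  by rewrite -symd_setC; apply: oddS => e; rewrite symd_setC => /split2[].
(* The parity of the distance enters once for each circle count and cancels, so B1 and B2 have
   genera of equal parity, against [g2] and [odd1]. *)
have := congr1 odd (euler_genus_partial_dual G B1).
have := congr1 odd (euler_genus_partial_dual G B2).
rewrite !oddD g2 /= odd1 oddB oddC.
by do 6!case: (odd _).
Qed.
End GenusSpectrum.

(** * From attained genera to gaps in the polynomial *)

Import GRing.Theory Num.Theory.
Local Open Scope ring_scope.

Section Polynomial.
Variables (E : finType) (G : ribbon_graph E).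
Local Notation genus A := (euler_genus (partial_dual G A)).

Lemma coef_pd_poly i : (pd_poly G)`_i = #|[set A | genus A == i]|%:R.
Proof.
rewrite coef_sum (eq_bigr (fun A => (genus A == i)%:R)) => [|A _].
  rewrite -natr_sum -sum1_card [in RHS]big_mkcond /=; congr (1 *+ _).
  by apply: eq_bigr => A _; rewrite inE; case: (_ == _).
by rewrite coefXn eq_sym.
Qed.

(** Coefficients are cardinals, so nothing cancels. *)
Lemma coef_pd_poly_neq0 i : reflect (exists A, genus A = i) ((pd_poly G)`_i != 0).
Proof.
rewrite coef_pd_poly pnatr_eq0 -lt0n.
by apply: (iffP card_gt0P) => -[A gA]; exists A; move: gA; rewrite inE => /eqP.
Qed.

Lemma pd_poly_interpolating (q : {poly int}) (b : bool) A :
  (forall i, q`_i = (pd_poly G)`_(i.*2 + b)) -> odd (genus A) = b -> interpolating q.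
Proof.
move=> qE oddA; split=> [|[i [j [i0 [j0 [nz gap]]]]]].
  apply/eqP=> q0; have /coef_pd_poly_neq0/negP : exists B, genus B = genus A by exists A.
  by rewrite -{1}[genus A]odd_double_half oddA addnC -qE q0 coef0 eqxx.
move: nz; rewrite mulf_eq0 negb_or !qE => /andP[/coef_pd_poly_neq0[B1 g1] /coef_pd_poly_neq0[B2 g2]].
(* The missing genus is the first one in the gap, 2i + b; B1 has genus two less, hence the same
   parity. *)
have [||| B gB] := @genus_intermediate E G (i.*2 + b)%N B1 B2.
- by rewrite g1; lia.
- by rewrite g2; lia.
- by rewrite g1 !oddD !odd_double.
have /coef_pd_poly_neq0/negP := ex_intro (fun B => genus B = _) B gB.
by rewrite -qE gap ?eqxx // leqnn -{1}[i]addn0 ltn_add2l.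
Qed.
End Polynomial.

Theorem theorem2 (E : finType) (G : ribbon_graph E) :
  even_polynomial (pd_poly G) \/ odd_polynomial (pd_poly G) \/
  (even_interpolating (pd_poly G) /\ odd_interpolating (pd_poly G)).
Proof.
have [/existsP[A oddA]|noodd] := boolP [exists A, odd (euler_genus (partial_dual G A))]; last first.
  left=> i oi; apply: contraNeq noodd => /coef_pd_poly_neq0[A gA].
  by apply/existsP; exists A; rewrite gA.
have [/existsP[B evenB]|noeven] := boolP [exists A, ~~ odd (euler_genus (partial_dual G A))]; last first.
  right; left=> i oi; apply: contraNeq noeven => /coef_pd_poly_neq0[B gB].
  by apply/existsP; exists B; rewrite gB.
(* The sets B and A of even and odd genus show that the respective parts are nonzero. *)
right; right; split.
  by apply: (@pd_poly_interpolating _ G _ false B) (negPf evenB) => i; rewrite coef_even_poly addn0.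
by apply: (@pd_poly_interpolating _ G _ true A) oddA => i; rewrite coef_odd_poly addn1.
Qed.
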